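(* Fix an integer $d \geq 2$, and for $n \geq d$ let $K_n = \frac{n-d}{2}$ and $\widehat{B}(K_n) = \{\sigma \in S_n \mid |\sigma| \geq K_n\}$. Then $\#\widehat{B}(K_n)$ grows on the order of $n!$ as $n \to \infty$, i.e. $n! = \mathcal{O}(\#\widehat{B}(K_n))$ and $\#\widehat{B}(K_n) = \mathcal{O}(n!)$; in particular, for all sufficiently large $n$, $$\#\widehat{B}(K_n) > (d-1)^{2n}.$$
   Context: For $\sigma \in S_n$, $|\sigma|$ denotes the word length of $\sigma$ with respect to the generating set of adjacent transpositions $t_i = (i,i+1)$, $1 \leq i \leq n-1$; equivalently $|\sigma|$ is the number of pairs $(i,j)$ with $1\leq i<j\leq n$ and $\sigma(j)<\sigma(i)$. $\#$ denotes cardinality. *)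

(* Defs.v *)
From mathcomp Require Import all_boot all_order all_algebra all_fingroup.
From mathcomp Require Import all_classical all_reals all_analysis.

Set Implicit Arguments.
Unset Strict Implicit.
Unset Printing Implicit Defensive.

Import Order.TTheory GRing.Theory Num.Theory GroupScope.

(* With points numbered 0, ..., n - 1, this is the set of (i, i + 1). *)
Definition adjacent_transpositions (n : nat) : {set 'S_n} :=
  [set s | [exists i : 'I_n, exists j : 'I_n,
     (j == i.+1 :> nat) && (s == tperm i j)]].

(* Inverses of generators need not be allowed as letters, since adjacent
   transpositions are involutions. *)
Definition has_word_of_size (n : nat) (s : 'S_n) (k : nat) : bool :=
  [exists w : k.-tuple 'S_n,
     all [in adjacent_transpositions n] w && (\prod_(t <- w) t == s)].

Lemma tperm_adjacent_gen (n : nat) (i j : 'I_n) :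
  tperm i j \in <<adjacent_transpositions n>>.
Proof.
wlog le_ij : i j / (i <= j)%N => [IH|].
  by case: (leqP i j) => [/IH //|/ltnW /IH]; rewrite tpermC.
case: j le_ij => m; elim: m => [|m IHm] lt_m /= le_im.
  have -> : i = Ordinal lt_m by apply/val_inj/eqP; rewrite -leqn0.
  by rewrite tperm1 group1.
have [eq_i|neq_i] := eqVneq (i : nat) m.+1.
  have -> : i = Ordinal lt_m by apply/val_inj.
  by rewrite tperm1 group1.
have le_im' : (i <= m)%N by rewrite -ltnS ltn_neqAle neq_i.
pose p := Ordinal (ltnW lt_m); pose q := Ordinal lt_m.
have pqA : tperm p q \in <<adjacent_transpositions n>>.
  by apply/mem_gen; rewrite inE; apply/existsP; exists p;
     apply/existsP; exists q; rewrite /= !eqxx.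
have [->//|neq_ip] := eqVneq i p.
have -> : tperm i q = tperm i p ^ tperm p q.
  by rewrite tpermJ tpermL tpermD // eq_sym.
by rewrite groupJ //; apply: IHm.
Qed.

Lemma has_wordP (n : nat) (s : 'S_n) : exists k, has_word_of_size s k.
Proof.
have : s \in <<adjacent_transpositions n>>.
  have [ts -> _] := prod_tpermP s.
  by apply: group_prod => t _; apply: tperm_adjacent_gen.
case/gen_prodgP => k [c cA ->]; exists k; apply/existsP.
exists [tuple c i | i < k]; apply/andP; split.
  by apply/allP => _ /mapP[i _ ->]; apply: cA.
by rewrite big_tuple; apply/eqP/eq_bigr => i _; rewrite tnth_mktuple.
Qed.

Definition word_length (n : nat) (s : 'S_n) : nat := ex_minn (has_wordP s).

Definition K (d n : nat) : rat := ((n%:R - d%:R) / 2%:R)%R.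

(* Only n >= d is meaningful; for n < d the bound is negative and this is all
   of 'S_n, which does not affect statements about n tending to infinity. *)
Definition Bhat (d n : nat) : {set 'S_n} :=
  [set s | (K d n <= (word_length s)%:R)%R].

(* Main.v *)
Require Import Defs.
From mathcomp Require Import all_boot all_order all_algebra all_fingroup.
From mathcomp Require Import all_classical all_reals all_analysis.
From mathcomp Require Import lra.
Import Order.TTheory GRing.Theory Num.Theory.
Import numFieldNormedType.Exports.

(** An adjacent transposition moves each point by at most one step, so a
permutation sending [i] to [j] has word length at least [`|i - j|]
([word_length_displacement]).  Let [u] exchange the first and the last of the
[n] points.  If [s] sends [i] to the first point, then [s * u] sends [i] to the
last one, so the lengths of [s] and [s * u] add up to at least [n - 1], which is
at least twice [K d n].  Hence [s] or [s * u] lies in [Bhat d n], for every [s].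
As [s |-> s * u] is a bijection, [Bhat d n] contains at least half of all
permutations ([leq_fact_Bhat]).  Both asymptotic bounds follow, and so does the
exponential one, because [x ^+ n / n`!] tends to [0] for every [x]. *)

Local Open Scope classical_set_scope.
Local Open Scope ring_scope.

Lemma adjacent_transposition_displacement {n : nat} {t : 'S_n} (i : 'I_n) :
  t \in adjacent_transpositions n -> (t i <= i.+1)%N /\ (i <= (t i).+1)%N.
Proof.
rewrite inE => /existsP[a /existsP[b /andP[/eqP ab /eqP ->]]].
by case: tpermP => [-> | -> | _ _]; rewrite ?ab; split; rewrite // ?leqnSn 1?ltnW.
Qed.

Lemma word_displacement {n : nat} (w : seq 'S_n) (i : 'I_n) :
  all [in adjacent_transpositions n] w ->
  ((\prod_(t <- w) t)%g i <= i + size w)%N /\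
  (i <= (\prod_(t <- w) t)%g i + size w)%N.
Proof.
elim: w i => [|t w IHw] i /=; first by rewrite big_nil perm1 addn0.
case/andP => /(adjacent_transposition_displacement i)[ti it] /(IHw (t i))[wt tw].
rewrite big_cons permM !addnS; split.
  by apply: leq_trans wt _; rewrite -addSn leq_add2r.
by apply: leq_trans it _; rewrite ltnS.
Qed.

Lemma word_length_displacement {n : nat} (s : 'S_n) (i : 'I_n) :
  (s i <= i + word_length s)%N /\ (i <= s i + word_length s)%N.
Proof.
rewrite /word_length; case: ex_minnP => k /existsP[w /andP[wA /eqP <-]] _.
by have := word_displacement _ i wA; rewrite size_tuple.
Qed.

(** Both one-sided bounds are applied at the point [s^-1 ord0]: [s] takes it down
to [0], and [s * tperm ord0 ord_max] takes it up to [n]. *)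
Lemma word_length_mul_tperm_ends {n : nat} (s : 'S_n.+1) :
  (n <= word_length s + word_length (s * tperm ord0 ord_max)%g)%N.
Proof.
pose i := (s^-1)%g ord0.
have [_] := word_length_displacement s i.
have [+ _] := word_length_displacement (s * tperm ord0 ord_max)%g i.
rewrite permM /i permKV tpermL /= add0n => le_n le_i.
by apply: leq_trans le_n _; rewrite leq_add2r.
Qed.

Lemma mem_Bhat_or_mul_tperm (d n : nat) (s : 'S_n.+1) : (0 < d)%N ->
  (s \in Bhat d n.+1) || ((s * tperm ord0 ord_max)%g \in Bhat d n.+1).
Proof.
move=> d_gt0; rewrite !inE; apply/contraT; rewrite negb_or -!ltNge /K.
have := word_length_mul_tperm_ends s.
rewrite -(ler_nat rat) natrD -(natr1 n).
by move: d_gt0; rewrite -(ler_nat rat) => d1 nw /andP[]; lra.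
Qed.

Lemma leq_fact_Bhat (d n : nat) : (0 < d)%N -> (n.+1`! <= 2 * #|Bhat d n.+1|)%N.
Proof.
move=> d_gt0; pose u : 'S_n.+1 := tperm ord0 ord_max.
have <- : #|[set: 'S_n.+1]%SET| = n.+1`! by rewrite cardsT card_Sn.
rewrite mul2n -addnn -{2}(card_preimset (Bhat d n.+1) (mulIg u)).
apply: leq_trans (leq_card_setU _ _).
apply/subset_leq_card/fintype.subsetP => s _.
by rewrite inE [in X in _ || X]inE mem_Bhat_or_mul_tperm.
Qed.

Lemma Bhat_leq_fact (d n : nat) : (#|Bhat d n| <= n`!)%N.
Proof. by rewrite -card_Sn; exact: max_card. Qed.

(** The terms [c%:R ^+ n / n`!%:R] of the convergent series for [expR c%:R] tend
to [0].  Comparing them with [m.+1%:R^-1] avoids a separate case for [m = 0]. *)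
Lemma near_mul_expn_lt_fact (R : realType) (m c : nat) :
  \forall n \near \oo, (m * c ^ n < n`!)%N.
Proof.
have /cvgr0_norm_lt/(_ m.+1%:R^-1) :=
  cvg_series_cvg_0 (is_cvg_series_exp_coeff (c%:R : R)).
rewrite invr_gt0 ltr0n => /(_ isT); apply: filterS => n.
rewrite /exp_coeff /= ger0_norm ?divr_ge0 ?exprn_ge0 ?ler0n //.
rewrite ltr_pdivrMr ?ltr0n ?fact_gt0 // mulrC ltr_pdivlMr ?ltr0n //.
rewrite -natrX -natrM ltr_nat mulnC; apply: leq_ltn_trans.
by rewrite leq_mul2r leqnSn orbT.
Qed.

Theorem mainTheorem2 (R : realType) (d : nat) (hd : (2 <= d)%N) :
  [/\ (fun n : nat => (n`!)%:R : R) =O_\oo (fun n : nat => #|Bhat d n|%:R : R),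
      (fun n : nat => #|Bhat d n|%:R : R) =O_\oo (fun n : nat => (n`!)%:R : R)
    & \forall n \near \oo, ((d - 1) ^ (2 * n) < #|Bhat d n|)%N].
Proof.
have half : \forall n \near \oo, (n`! <= 2 * #|Bhat d n|)%N.
  by exists 1%N => // -[//|n] _; apply: leq_fact_Bhat; apply: ltnW.
split.
- apply/eqO_exP; exists 2; first exact: ltr0n.
  by apply: filterS half => n; rewrite !normr_nat -natrM ler_nat.
- apply/eqO_exP; exists 1; first exact: ltr01.
  by apply: nearW => n; rewrite !normr_nat mul1r ler_nat Bhat_leq_fact.
- apply: filterS2 half (near_mul_expn_lt_fact R 2 ((d - 1) ^ 2)) => n.
  by rewrite -expnM => le_fact /leq_trans/(_ le_fact); rewrite ltn_pmul2l.
Qed.
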